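(* Let $N\ge1$, $r_i>0$ for $i=1,\dots,N$, and $S_u=\bigsqcup_{i=1}^N\{i\}\times[0,r_i]$; write $f\in C(S_u)$ as $f=\sum_i f_i$ with $f_i\in C[0,r_i]$. Let $p_i,q_i\in[0,1]$, $c_i,d_i>0$, and let $\mathfrak p_{i,1},\mathfrak p_{i,2}$, $i=1,\dots,N$, be Borel sub-probability measures on $S_u$. Let $A$ be the operator $Af=\tfrac12 f''$ (i.e. $(Af)_i=\tfrac12 f_i''$) with domain consisting of those $f$ with each $f_i\in C^2[0,r_i]$ and $$p_if_i''(0)-(1-p_i)f_i'(0)+c_if_i(0)=c_i\int f\,\mathrm d\mathfrak p_{i,1},\qquad q_if_i''(r_i)+(1-q_i)f_i'(r_i)+d_if_i(r_i)=d_i\int f\,\mathrm d\mathfrak p_{i,2}$$ for all $i$. For each $i$ let $A_i$ be the operator $A_if=\tfrac12 f''$ on $C[0,r_i]$ with domain the $f\in C^2[0,r_i]$ with $p_if''(0)-(1-p_i)f'(0)+c_if(0)=0$ and $q_if''(r_i)+(1-q_i)f'(r_i)+d_if(r_i)=0$; it generates a Feller semigroup with resolvent $R_{\lambda,i}$. For $\lambda>0$, with $s=\sqrt{2\lambda}$, let $$a^i_{1,1}=2\lambda p_i-s(1-p_i)+c_i,\quad a^i_{1,2}=2\lambda p_i+s(1-p_i)+c_i,$$ $$a^i_{2,1}=e^{sr_i}(2\lambda q_i+s(1-q_i)+d_i),\quad a^i_{2,2}=e^{-sr_i}(2\lambda q_i-s(1-q_i)+d_i),$$ $W_i=a^i_{1,1}a^i_{2,2}-a^i_{1,2}a^i_{2,1}$,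 and for $x\in[0,r_i]$ $$\ell^{i,1}_\lambda(x)=\tfrac{c_i}{W_i}\big(a^i_{2,2}e^{sx}-a^i_{2,1}e^{-sx}\big),\qquad \ell^{i,2}_\lambda(x)=\tfrac{d_i}{W_i}\big(a^i_{1,1}e^{-sx}-a^i_{1,2}e^{sx}\big)$$ (extended by $0$ outside the $i$th interval). For $g\in C(S_u)$ set $R^{du}_\lambda g=\sum_iR_{\lambda,i}g_i$, let $(u_{i,j})_{i\le N,j\in\{1,2\}}$ be the unique solution of $$u_{i,j}=\int R^{du}_\lambda g\,\mathrm d\mathfrak p_{i,j}+\sum_{k=1}^N\sum_{l=1}^2u_{k,l}\int\ell^{k,l}_\lambda\,\mathrm d\mathfrak p_{i,j},$$ and $R^{co}_\lambda g=R^{du}_\lambda g+\sum_{i=1}^N\sum_{j=1}^2u_{i,j}\ell^{i,j}_\lambda$. Then for every $\lambda>0$ and $g\in C(S_u)$ there is a unique $f$ in the domain of $A$ with $\lambda f-Af=g$, and this $f$ equals $R^{co}_\lambda g$.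
   Context: $C[0,r]$ denotes real continuous functions on $[0,r]$, $C^2[0,r]$ twice continuously differentiable functions (one-sided derivatives at endpoints). A Feller semigroup is a strongly continuous semigroup of positive contractions with $T(0)=I$, not necessarily conservative. The functions $\ell^{i,1}_\lambda,\ell^{i,2}_\lambda$ are the Laplace transforms of the two exit laws of $A_i$ (exits through $0$ and through $r_i$), and the linear system defining $(u_{i,j})$ is uniquely solvable. *)

(* Defs.v *)
From HB Require Import structures.
From mathcomp Require Import all_boot all_order all_algebra.
From mathcomp Require Import all_classical all_reals all_analysis.
Set Implicit Arguments. Unset Strict Implicit. Unset Printing Implicit Defensive.
Import Order.TTheory GRing.Theory Num.Theory.
Import numFieldNormedType.Exports.
Local Open Scope classical_set_scope.
Local Open Scope ring_scope.

(* Functions on S_u = disjoint union of {i} x [0, r_i] are represented as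
   families f : 'I_N -> R -> R; only the values f i x with 0 <= x <= r i matter. *)

Definition has_deriv_within {R : realType} (a b : R) (f : R -> R) (x l : R) : Prop :=
  (fun y => (f y - f x) / (y - x)) @
    within (fun y => (a <= y <= b) /\ y != x) (nbhs x) --> l.

Definition C2_on {R : realType} (a b : R) (f f1 f2 : R -> R) : Prop :=
  {within `[a, b], continuous f2} /\
  forall x, a <= x <= b -> has_deriv_within a b f x (f1 x) /\
                           has_deriv_within a b f1 x (f2 x).

(* A Borel measure on S_u is represented as a family of Borel measures
   on R, the k-th one being its restriction to the k-th interval [0, r k]. *)
Definition Su_measure {R : realType} (N : nat) := 'I_N -> {measure set R -> \bar R}.

Definition sub_probability {R : realType} {N : nat} (r : 'I_N -> R)
  (mu : @Su_measure R N) : Prop :=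
  (\sum_(k < N) mu k `[0%R, r k]%classic <= 1)%E.

Definition Su_integral {R : realType} {N : nat} (r : 'I_N -> R)
  (mu : @Su_measure R N) (f : 'I_N -> R -> R) : R :=
  \sum_(k < N) Rintegral (mu k) `[0, r k] (f k).

Definition solves_Ai {R : realType} (p q c d r lam : R) (g f : R -> R) : Prop :=
  exists f1 f2 : R -> R,
    C2_on 0 r f f1 f2 /\
    p * f2 0 - (1 - p) * f1 0 + c * f 0 = 0 /\
    q * f2 r + (1 - q) * f1 r + d * f r = 0 /\
    forall x, 0 <= x <= r -> lam * f x - f2 x / 2 = g x.

Definition resolvent_Ai {R : realType} (p q c d r lam : R) (g : R -> R) : R -> R :=
  xget (fun _ => 0) [set f | solves_Ai p q c d r lam g f].

Definition solves_A {R : realType} {N : nat} (r p q c d : 'I_N -> R)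
  (P : 'I_N -> 'I_2 -> @Su_measure R N) (lam : R) (g f : 'I_N -> R -> R) : Prop :=
  forall i, exists f1 f2 : R -> R,
    C2_on 0 (r i) (f i) f1 f2 /\
    p i * f2 0 - (1 - p i) * f1 0 + c i * f i 0 = c i * Su_integral r (P i ord0) f /\
    q i * f2 (r i) + (1 - q i) * f1 (r i) + d i * f i (r i)
      = d i * Su_integral r (P i (@Ordinal 2 1 isT)) f /\
    forall x, 0 <= x <= r i -> lam * f i x - f2 x / 2 = g i x.

Section ell.
Context {R : realType} {N : nat} (r p q c d : 'I_N -> R) (lam : R).
Let s := Num.sqrt (2 * lam).
Definition a11 i := 2 * lam * p i - s * (1 - p i) + c i.
Definition a12 i := 2 * lam * p i + s * (1 - p i) + c i.
Definition a21 i := expR (s * r i) * (2 * lam * q i + s * (1 - q i) + d i).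
Definition a22 i := expR (- (s * r i)) * (2 * lam * q i - s * (1 - q i) + d i).
Definition Wr i := a11 i * a22 i - a12 i * a21 i.
(* ell i 0 = l^{i,1}_lam, ell i 1 = l^{i,2}_lam, as functions on [0, r i] *)
Definition ell (i : 'I_N) (l : 'I_2) (x : R) : R :=
  if l == ord0 then c i / Wr i * (a22 i * expR (s * x) - a21 i * expR (- (s * x)))
  else d i / Wr i * (a11 i * expR (- (s * x)) - a12 i * expR (s * x)).
Definition ellS (k : 'I_N) (l : 'I_2) : 'I_N -> R -> R :=
  fun m x => if m == k then ell k l x else 0.
End ell.

Definition R_du {R : realType} {N : nat} (r p q c d : 'I_N -> R) (lam : R)
  (g : 'I_N -> R -> R) : 'I_N -> R -> R :=
  fun i => resolvent_Ai (p i) (q i) (c i) (d i) (r i) lam (g i).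

Definition u_system {R : realType} {N : nat} (r p q c d : 'I_N -> R)
  (P : 'I_N -> 'I_2 -> @Su_measure R N) (lam : R) (g : 'I_N -> R -> R)
  (u : 'I_N -> 'I_2 -> R) : Prop :=
  forall i j, u i j = Su_integral r (P i j) (R_du r p q c d lam g) +
    \sum_(k < N) \sum_(l < 2) u k l * Su_integral r (P i j) (ellS r p q c d lam k l).

Definition R_co {R : realType} {N : nat} (r p q c d : 'I_N -> R) (lam : R)
  (g : 'I_N -> R -> R) (u : 'I_N -> 'I_2 -> R) : 'I_N -> R -> R :=
  fun i x => R_du r p q c d lam g i x +
    \sum_(k < N) \sum_(l < 2) u k l * ellS r p q c d lam k l i x.

Definition Su_eq {R : realType} {N : nat} (r : 'I_N -> R) (f h : 'I_N -> R -> R) : Prop :=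
  forall i x, 0 <= x <= r i -> f i x = h i x.

(* Main.v *)
Require Import Defs.
From HB Require Import structures.
From mathcomp Require Import all_boot all_order all_algebra.
From mathcomp Require Import all_classical all_reals all_analysis.
From mathcomp Require Import measurable_realfun ring lra.
Import Order.TTheory GRing.Theory Num.Theory.
Import numFieldNormedType.Exports.
Local Open Scope classical_set_scope.
Local Open Scope ring_scope.
Set Implicit Arguments. Unset Strict Implicit. Unset Printing Implicit Defensive.

(** Uniqueness is a maximum principle: if g = 0, then wherever a solution f is
    positive, f'' = 2 lam f > 0, so a positive global maximum sits at an endpoint
    with strictly positive outward derivative, and the boundary condition there
    makes the integral of f against a sub-probability measure exceed max f.
    The functions ell i j solve the homogeneous equation on the i-th interval
    with boundary data c_i or d_i at one end and 0 at the other, so adding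
    sum u_ij ell_ij to R_du g solves the coupled problem as soon as u_ij is the
    integral of the resulting function, which is the linear system for u.
    That square system is solvable because its kernel is trivial, again by
    uniqueness for the coupled problem. *)

(** * Derivatives and continuity relative to a closed interval *)

Section within_derivative.
Context {R : realType}.
Implicit Types (a b x l k : R) (f h : R -> R).

Lemma within_itv_cvgP a b f :
  {within `[a, b], continuous f} <->
  forall x, a <= x <= b -> f @ within (fun y => a <= y <= b) (nbhs x) --> f x.
Proof.
split.
- move=> /subspace_continuousP cf x xab.
  have := cf x; rewrite /= in_itv/= => /(_ xab).
  suff -> : (fun y => is_true (a <= y <= b)) = `[a, b]%classic by [].
  by apply/seteqP; split=> y /=; rewrite in_itv.
- move=> cf; apply/subspace_continuousP => x; rewrite /= in_itv/= => /cf.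
  suff -> : (fun y => is_true (a <= y <= b)) = `[a, b]%classic by [].
  by apply/seteqP; split=> y /=; rewrite in_itv.
Qed.

Lemma is_derive_has_deriv_within a b f x l :
  is_derive x 1 f l -> has_deriv_within a b f x l.
Proof.
move=> /is_derive1_caratheodory[g [fg cg <-]].
rewrite /has_deriv_within.
apply: (@cvg_trans _ (g @ within (fun y => (a <= y <= b) /\ y != x) (nbhs x))).
  apply: near_eq_cvg; apply: filterS (withinT _ _) => y /= [_ yx].
  by rewrite fg mulfK// subr_eq0.
exact: cvg_within_filter.
Qed.

(** Near an interior point the constraint to [[a, b]] is vacuous, so the relative derivative is a
    genuine two-sided one, as the mean value theorem requires. *)
Lemma has_deriv_within_is_derive a b f x l : a < x < b ->
  has_deriv_within a b f x l -> is_derive x 1 f l.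
Proof.
move=> /andP[ax xb] fl; apply/is_derive1_caratheodory.
(* Carathéodory's function: the difference quotient, completed by [l] at [x]. *)
exists (fun y => if y == x then l else (f y - f x) / (y - x)); split.
- move=> z; case: eqVneq => [->|zx]; first by rewrite !subrr mulr0.
  by rewrite divfK// subr_eq0.
- rewrite /prop_for /continuous_at eqxx.
  apply/cvgrPdist_lt => e e0; move/cvgrPdist_lt: fl => /(_ _ e0).
  rewrite near_withinE => fl; near=> y.
  case: eqVneq => [_|yx]; first by rewrite subrr normr0.
  suff : (a <= y <= b) /\ y != x by near: y; exact: fl.
  split=> //; apply/andP; split; apply: ltW; near: y.
    exact: lt_nbhsr.
  exact: lt_nbhsl.
- by rewrite eqxx.
Unshelve. all: by end_near. Qed.

Lemma has_deriv_within_continuous a b f f1 :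
  (forall x, a <= x <= b -> has_deriv_within a b f x (f1 x)) ->
  {within `[a, b], continuous f}.
Proof.
move=> df; apply/within_itv_cvgP => x xab.
pose F := within (fun y => (a <= y <= b) /\ y != x) (nbhs x).
have fx : f @ F --> f x.
  have id0 : (fun y => y - x) @ F --> x - x.
    by apply: cvg_within_filter; apply: cvgB; [exact: cvg_id|exact: cvg_cst].
  have cst : (fun=> f x) @ F --> f x by exact: cvg_cst.
  have := cvgD (cvgM (df x xab) id0) cst; rewrite subrr mulr0 add0r => H.
  apply: (@cvg_trans _ ((fun y => (f y - f x) / (y - x) * (y - x) + f x) @ F)).
    apply: near_eq_cvg; apply: filterS (withinT _ _) => y /= [_ yx].
    by rewrite divfK ?subr_eq0// subrK.
  exact: H.
(* The punctured filter [F] says nothing at [x] itself, where the distance to [f x] is 0. *)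
apply/cvgrPdist_lt => e e0; move/cvgrPdist_lt: fx => /(_ _ e0).
rewrite !near_withinE; apply: filterS => y fy yab.
have [->|yx] := eqVneq y x; first by rewrite subrr normr0.
exact: fy.
Qed.

Lemma has_deriv_within_comb a b f h x l m k :
  has_deriv_within a b f x l -> has_deriv_within a b h x m ->
  has_deriv_within a b (fun y => f y + k * h y) x (l + k * m).
Proof.
move=> fl hm; rewrite /has_deriv_within.
have -> : (fun y => (f y + k * h y - (f x + k * h x)) / (y - x)) =
   (fun y => (f y - f x) / (y - x) + k * ((h y - h x) / (y - x))).
  apply/funext => y; ring.
by apply: cvgD => //; apply: cvgMr.
Qed.

Lemma C2_on_comb a b f f1 f2 h h1 h2 k :
  C2_on a b f f1 f2 -> C2_on a b h h1 h2 ->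
  C2_on a b (fun x => f x + k * h x) (fun x => f1 x + k * h1 x)
    (fun x => f2 x + k * h2 x).
Proof.
move=> [cf df] [ch dh]; split.
  apply/within_itv_cvgP => x xab.
  move/within_itv_cvgP: cf => /(_ x xab) cf.
  move/within_itv_cvgP: ch => /(_ x xab) ch.
  by apply: cvgD => //; apply: cvgMr.
move=> x xab; have [? ?] := df _ xab; have [? ?] := dh _ xab.
by split; exact: has_deriv_within_comb.
Qed.
End within_derivative.

(** * Boundary value problems on one interval and the maximum principle *)

Section boundary_value_problem.
Context {R : realType}.
Implicit Types (a b p q c d r lam : R) (f g h : R -> R).

(** A common form for the three problems at hand: data [(0, 0)] describe the resolvent of [A_i],
    data [(1, 0)] and [(0, 1)] with [g = 0] the two exit functions [ell], and integrals of the
    solution as data the coupled operator. *)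
Definition bvp p q c d r lam g b0 b1 f : Prop :=
  exists f1 f2 : R -> R,
    C2_on 0 r f f1 f2 /\
    p * f2 0 - (1 - p) * f1 0 + c * f 0 = c * b0 /\
    q * f2 r + (1 - q) * f1 r + d * f r = d * b1 /\
    forall x, 0 <= x <= r -> lam * f x - f2 x / 2 = g x.

Lemma solves_AiE p q c d r lam g f :
  solves_Ai p q c d r lam g f <-> bvp p q c d r lam g 0 0 f.
Proof. by rewrite /bvp !mulr0. Qed.

Lemma bvp_eq_rhs p q c d r lam g g' b0 b1 f :
  (forall x, 0 <= x <= r -> g x = g' x) ->
  bvp p q c d r lam g b0 b1 f -> bvp p q c d r lam g' b0 b1 f.
Proof.
move=> gg' [f1 [f2 [C2f [? [? E]]]]]; exists f1, f2; do 3 split => //.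
by move=> x xr; rewrite E// gg'.
Qed.

Lemma bvp_comb k p q c d r lam g g' b0 b0' b1 b1' f f' :
  bvp p q c d r lam g b0 b1 f -> bvp p q c d r lam g' b0' b1' f' ->
  bvp p q c d r lam (fun x => g x + k * g' x) (b0 + k * b0') (b1 + k * b1')
    (fun x => f x + k * f' x).
Proof.
move=> [f1 [f2 [C2f [f0 [fr Ef]]]]] [h1 [h2 [C2h [h0 [hr Eh]]]]].
exists (fun x => f1 x + k * h1 x), (fun x => f2 x + k * h2 x).
split; first exact: C2_on_comb.
split; first by rewrite [RHS]mulrDr [X in _ = _ + X]mulrCA -f0 -h0; ring.
split; first by rewrite [RHS]mulrDr [X in _ = _ + X]mulrCA -fr -hr; ring.
by move=> x xr; rewrite -Ef// -Eh//; field.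
Qed.

Lemma bvp_continuous p q c d r lam g b0 b1 f :
  bvp p q c d r lam g b0 b1 f -> {within `[0, r], continuous f}.
Proof.
move=> [f1 [f2 [[_ df] _]]]; apply: (@has_deriv_within_continuous _ _ _ _ f1).
by move=> x /df[].
Qed.

Lemma has_deriv_within_gt0_near a b f x l : has_deriv_within a b f x l -> 0 < l ->
  exists2 e, 0 < e & forall y, a <= y <= b -> `|x - y| < e -> y != x ->
    0 < (f y - f x) / (y - x).
Proof.
move=> /cvgrPdist_lt/[apply]; rewrite near_withinE => -[e /= e0 He].
exists e => // y yab xy yx; have /= := He y xy (conj yab yx).
rewrite ltr_norml => /andP[_]; lra.
Qed.

Lemma MVT_has_deriv_within a b f f1 x y : a <= x -> x < y -> y <= b ->
  (forall z, a <= z <= b -> has_deriv_within a b f z (f1 z)) ->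
  exists2 z, x < z < y & f y - f x = f1 z * (y - x).
Proof.
move=> ax xy yb df.
have cf := has_deriv_within_continuous df.
have [||z + E] := @MVT _ f f1 x y xy.
- move=> z; rewrite in_itv/= => /andP[xz zy].
  apply: (@has_deriv_within_is_derive _ a b); first by apply/andP; split; lra.
  by apply: df; apply/andP; split; lra.
- apply: continuous_subspaceW cf => z /=; rewrite !in_itv/= => /andP[? ?].
  by apply/andP; split; lra.
- by rewrite in_itv/=; exists z.
Qed.

(** If [f1 x >= 0], then [f2 x > 0] makes [f1] positive just to the right of [x], so [f] increases
    strictly there, against maximality. The point [x] may be the left endpoint. *)
Lemma C2_on_max_right a b f f1 f2 x : C2_on a b f f1 f2 -> a <= x < b ->
  (forall y, a <= y <= b -> f y <= f x) -> 0 < f2 x -> f1 x < 0.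
Proof.
move=> [_ df] /andP[ax xb] fx f2x; rewrite ltNge; apply/negP => f1x.
have xab : a <= x <= b by rewrite ax ltW.
have [e e0 He] := has_deriv_within_gt0_near (df x xab).2 f2x.
(* The minimum keeps [y] in the interval, and [e / 2] keeps every point between [x] and [y] at
   distance less than [e] from [x]. *)
set y := Num.min b (x + e / 2).
have yb : y <= b by rewrite ge_min lexx.
have ye : y <= x + e / 2 by rewrite ge_min lexx orbT.
have xy : x < y by rewrite lt_min xb/=; lra.
have [|z /andP[xz zy] E] := @MVT_has_deriv_within a b f f1 x y ax xy yb.
  by move=> z /df[].
have := fx y; have -> : (a <= y <= b) by apply/andP; split; lra.
move=> /(_ isT); apply/negP; rewrite -ltNge -subr_gt0 E mulr_gt0 ?subr_gt0//.
apply: le_lt_trans f1x _; rewrite -subr_gt0.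
have : 0 < (f1 z - f1 x) / (z - x).
  apply: He; first by apply/andP; split; lra.
    by rewrite ltr_norml; apply/andP; split; lra.
  by rewrite gt_eqF.
by rewrite pmulr_lgt0// invr_gt0 subr_gt0.
Qed.

(** The mirror image, in which [x] may be the right endpoint. *)
Lemma C2_on_max_left a b f f1 f2 x : C2_on a b f f1 f2 -> a < x <= b ->
  (forall y, a <= y <= b -> f y <= f x) -> 0 < f2 x -> 0 < f1 x.
Proof.
move=> [_ df] /andP[ax xb] fx f2x; rewrite ltNge; apply/negP => f1x.
have xab : a <= x <= b by rewrite xb ltW.
have [e e0 He] := has_deriv_within_gt0_near (df x xab).2 f2x.
set y := Num.max a (x - e / 2).
have yb : a <= y by rewrite le_max lexx.
have ye : x - e / 2 <= y by rewrite le_max lexx orbT.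
have xy : y < x by rewrite gt_max ax/=; lra.
have [|z /andP[xz zy] E] := @MVT_has_deriv_within a b f f1 y x yb xy xb.
  by move=> z /df[].
have := fx y; have -> : (a <= y <= b) by apply/andP; split; lra.
move=> /(_ isT); apply/negP; rewrite -ltNge -subr_lt0 E nmulr_rlt0 ?subr_gt0//.
apply: lt_le_trans f1x; rewrite -subr_gt0.
have : 0 < (f1 z - f1 x) / (z - x).
  apply: He; first by apply/andP; split; lra.
    by rewrite ltr_norml; apply/andP; split; lra.
  by rewrite lt_eqF.
by rewrite nmulr_lgt0 ?invr_lt0 ?subr_lt0// subr_gt0.
Qed.

(** At a positive maximum the equation gives [f2 x > 0]. At an endpoint the outward derivative is
    then positive too, so the boundary condition forces the boundary datum strictly above [f x]. *)
Lemma bvp_max_le0 p q c d r lam b0 b1 f x :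
  0 < r -> 0 <= p <= 1 -> 0 <= q <= 1 -> 0 < c -> 0 < d -> 0 < lam ->
  bvp p q c d r lam (fun=> 0) b0 b1 f ->
  0 <= x <= r -> (forall y, 0 <= y <= r -> f y <= f x) ->
  (0 < f x -> b0 <= f x /\ b1 <= f x) -> f x <= 0.
Proof.
move=> r0 /andP[p0 p1] /andP[q0 q1] c0 d0 l0 [f1 [f2 [C2f [f0 [fr Ef]]]]].
move=> /andP[x0 xr] fx bx; rewrite leNgt; apply/negP => fx0.
have [b0x b1x] := bx fx0.
have f2x : 0 < f2 x.
  have := Ef x; rewrite x0 xr => /(_ isT); have : 0 < lam * f x by exact: mulr_gt0.
  lra.
(* Applied with [v] the second derivative and [w] the outward derivative, so that the derivative
   terms of either boundary condition are strictly positive. *)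
have pos (t v w : R) : 0 <= t -> t <= 1 -> 0 < v -> 0 < w -> 0 < t * v + (1 - t) * w.
  by move=> *; nra.
have [xr'|] := ltP x r; last first.
  move=> rx; have xE : x = r by apply/eqP; rewrite eq_le xr rx.
  subst x; have f1r : 0 < f1 r.
    by apply: (C2_on_max_left C2f) => //; rewrite r0 lexx.
  have := pos q _ _ q0 q1 f2x f1r; have : d * b1 <= d * f r by rewrite ler_pM2l.
  lra.
have f1x : f1 x < 0 by apply: (C2_on_max_right C2f) => //; rewrite x0 xr'.
(* At an interior maximum the two one-sided lemmas give [f1 x] opposite strict signs. *)
move: x0; rewrite le_eqVlt => /predU1P[xE|x0]; last first.
  suff : 0 < f1 x by lra.
  by apply: (C2_on_max_left C2f) => //; rewrite x0 xr.
subst x; have f1N : 0 < - f1 0 by lra.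
have := pos p _ _ p0 p1 f2x f1N; have : c * b0 <= c * f 0 by rewrite ler_pM2l.
lra.
Qed.
End boundary_value_problem.

(** * Variation of constants and existence of the resolvent on one interval *)

Section resolvent.
Context {R : realType}.
Implicit Types (a b c d p q r s x l lam : R) (f g F G : R -> R).

(** Composing [g] with the projection onto [[a, b]] extends it continuously to the whole line, and
    the fundamental theorem of calculus applies to the extension. *)
Lemma within_continuous_antiderivative a b g : {within `[a, b], continuous g} ->
  exists G, forall x, a <= x <= b -> is_derive x 1 G (g x).
Proof.
move=> cg; have [ab|ba] := leP a b; last first.
  by exists g => x /andP[? ?]; exfalso; lra.
pose clip y : R := Num.max a (Num.min y b).
have clip_itv y : a <= clip y <= b.
  by rewrite le_max lexx ge_max ab ge_min lexx orbT.
have cclip : continuous clip.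
  move=> y; have cmin : {for y, continuous ((@id R) \min (fun=> b))}.
    by apply: continuous_min; [exact: cvg_id|exact: cvg_cst].
  have cmax : {for y, continuous ((fun=> a) \max ((@id R) \min (fun=> b)))}.
    by apply: continuous_max => //; exact: cvg_cst.
  exact: cmax.
pose h := g \o clip.
have ch : continuous h.
  move=> y; pose F := within (fun z => a <= z <= b) (nbhs (clip y)).
  (* Relative continuity of [g] is enough, because [clip] takes all its values in [[a, b]]. *)
  apply: (@cvg_comp _ _ _ clip g _ F).
    move=> A; rewrite /= /within/= => A1.
    have A2 : \forall z \near y, a <= clip z <= b -> A (clip z) := cclip y _ A1.
    suff : \forall z \near y, A (clip z) by [].
    by apply: filterS A2 => z Az; exact: (Az (clip_itv z)).
  by move/within_itv_cvgP: cg; exact.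
(* Starting at [a - 1], and integrating up to [b + 1] at most, makes both endpoints interior, so the
   derivative is two-sided there as well. *)
exists (fun x => \int[lebesgue_measure]_(t in `[a - 1, x]) h t) => x /andP[ax xb].
have ih : lebesgue_measure.-integrable `[a - 1, b + 1] (EFin \o h).
  apply: continuous_compact_integrable; first exact: segment_compact.
  exact: continuous_subspaceT.
have [||dG EG] := continuous_FTC1_closed (x := x) _ ih _ (ch x); [lra|lra|].
have -> : g x = h x.
  by rewrite /h /clip /= (min_l xb) (max_r ax).
by apply: (DeriveDef dG); rewrite -derive1E EG.
Qed.

Lemma is_deriveMl s F x l : is_derive x 1 F l ->
  is_derive x 1 (fun y => s * F y) (s * l).
Proof. by move=> dF; have := @is_deriveZ R R R F s x 1 l dF. Qed.

Lemma is_derive_expRM s F x l : is_derive x 1 F l ->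
  is_derive x 1 (fun y => expR (s * y) * F y)
    (s * (expR (s * x) * F x) + expR (s * x) * l).
Proof.
move=> dF.
have dl : is_derive x 1 (fun y : R => s * y) s.
  by have := is_deriveMl s (is_derive_id x 1); rewrite mulr1.
have de := is_derive1_comp (is_derive_expR (s * x)) dl.
have := is_deriveM de dF; rewrite /GRing.scale/= => dM.
rewrite (_ : s * _ + _ = expR (s * x) * l + F x * (expR (s * x) * s)); last by ring.
exact: dM.
Qed.

(** Variation of constants: the terms with [F'] and [G'] are [- g / s] and [g / s]. They cancel in
    the first derivative and contribute [- 2 g] to the second, so for [s ^+ 2 = 2 * lam] the
    function solves the resolvent equation. *)
Lemma C2_on_variation a b s g F G : s != 0 -> {within `[a, b], continuous g} ->
  (forall x, a <= x <= b -> is_derive x 1 F (- (expR (- (s * x)) * g x / s))) ->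
  (forall x, a <= x <= b -> is_derive x 1 G (expR (s * x) * g x / s)) ->
  C2_on a b (fun x => expR (s * x) * F x + expR (- (s * x)) * G x)
    (fun x => s * (expR (s * x) * F x - expR (- (s * x)) * G x))
    (fun x => s ^+ 2 * (expR (s * x) * F x + expR (- (s * x)) * G x) - 2 * g x).
Proof.
move=> s0 cg dF dG.
pose E x := expR (s * x) * F x; pose H x := expR (- (s * x)) * G x.
have ee x : expR (s * x) * expR (- (s * x)) = 1 by rewrite expRxMexpNx_1.
have dE x : a <= x <= b -> is_derive x 1 E (s * E x - g x / s).
  move=> /dF/(is_derive_expRM s).
  by rewrite [X in _ + X](_ : _ = - (g x / s)) // mulrN !mulrA ee mul1r.
have dH x : a <= x <= b -> is_derive x 1 H (- s * H x + g x / s).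
  have -> : H = (fun y => expR (- s * y) * G y) by apply/funext => y; rewrite mulNr.
  move=> /dG/(is_derive_expRM (- s)).
  by rewrite [X in _ + X](_ : _ = g x / s) // mulNr !mulrA [expR (- _) * _]mulrC ee mul1r.
have d1 x : a <= x <= b -> has_deriv_within a b (fun x => E x + H x) x (s * (E x - H x)).
  move=> xab; apply: is_derive_has_deriv_within.
  rewrite (_ : s * (E x - H x) = s * E x - g x / s + (- s * H x + g x / s)); last by ring.
  exact: (@is_deriveD R R R _ _ _ _ _ _ (dE x xab) (dH x xab)).
have d2 x : a <= x <= b ->
    has_deriv_within a b (fun x => s * (E x - H x)) x (s ^+ 2 * (E x + H x) - 2 * g x).
  move=> xab; apply: is_derive_has_deriv_within.
  rewrite (_ : s ^+ 2 * _ - _ = s * (s * E x - g x / s - (- s * H x + g x / s))).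
    exact: (is_deriveMl s (@is_deriveB R R R _ _ _ _ _ _ (dE x xab) (dH x xab))).
  by field.
split=> [|x xab]; last by split; [exact: d1|exact: d2].
apply/within_itv_cvgP => x xab.
have /within_itv_cvgP/(_ x xab) cEH := has_deriv_within_continuous d1.
move/within_itv_cvgP: cg => /(_ x xab) cg.
by apply: cvgB; apply: cvgMr.
Qed.

(** The case [g = 0], where the coefficients [F] and [G] are constant. *)
Lemma C2_on_expR a b s u v : s != 0 ->
  C2_on a b (fun x => u * expR (s * x) + v * expR (- (s * x)))
    (fun x => s * (u * expR (s * x) - v * expR (- (s * x))))
    (fun x => s ^+ 2 * (u * expR (s * x) + v * expR (- (s * x)))).
Proof.
move=> s0.
have := @C2_on_variation a b s (fun=> 0) (fun=> u) (fun=> v) s0.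
have -> : (fun x => s ^+ 2 * (expR (s * x) * u + expR (- (s * x)) * v) - 2 * 0) =
  (fun x => s ^+ 2 * (u * expR (s * x) + v * expR (- (s * x)))).
  by apply/funext => x; ring.
have -> : (fun x => s * (expR (s * x) * u - expR (- (s * x)) * v)) =
  (fun x => s * (u * expR (s * x) - v * expR (- (s * x)))).
  by apply/funext => x; ring.
have -> : (fun x => expR (s * x) * u + expR (- (s * x)) * v) =
  (fun x => u * expR (s * x) + v * expR (- (s * x))).
  by apply/funext => x; ring.
apply.
- by apply: continuous_subspaceT => ?; exact: cvg_cst.
- by move=> x _; rewrite mulr0 mul0r oppr0; exact: is_derive_cst.
- by move=> x _; rewrite mulr0 mul0r; exact: is_derive_cst.
Qed.

(** Apart from the exponentials, the factors of [a11 * a22] are bounded in absolute value by those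
    of [a12 * a21], which are positive; strictness comes from
    [expR (- (s * r i)) < expR (s * r i)]. *)
Lemma Wr_lt0 N (r p q c d : 'I_N -> R) lam i :
  0 < r i -> 0 <= p i <= 1 -> 0 <= q i <= 1 -> 0 < c i -> 0 < d i -> 0 < lam ->
  Wr r p q c d lam i < 0.
Proof.
move=> r0 /andP[p0 p1] /andP[q0 q1] c0 d0 l0.
rewrite /Wr /a11 /a12 /a21 /a22 subr_lt0.
set s := Num.sqrt _; have s0 : 0 < s by rewrite sqrtr_gt0 mulr_gt0.
set e := expR (s * r i); set e' := expR (- (s * r i)).
have e'0 : 0 < e' by exact: expR_gt0.
have ee' : e' < e by rewrite ltr_expR -subr_gt0 opprK; have := mulr_gt0 s0 r0; lra.
set A := 2 * lam * p i; set B := s * (1 - p i).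
set D := 2 * lam * q i; set E := s * (1 - q i).
have A0 : 0 <= A by rewrite !mulr_ge0// ltW.
have B0 : 0 <= B by rewrite mulr_ge0 ?subr_ge0// ltW.
have D0 : 0 <= D by rewrite !mulr_ge0// ltW.
have E0 : 0 <= E by rewrite mulr_ge0 ?subr_ge0// ltW.
set X := A + B + c i; set Y := D + E + d i.
have X0 : 0 < X by rewrite /X; lra.
have Y0 : 0 < Y by rewrite /Y; lra.
rewrite mulrCA [ltRHS]mulrCA.
apply: (@le_lt_trans _ _ (e' * (X * Y))); last by rewrite ltr_pM2r// mulr_gt0.
rewrite ler_pM2l//; apply: le_trans (ler_norm _) _; rewrite normrM.
by apply: ler_pM => //; rewrite ler_norml /X /Y; apply/andP; split; lra.
Qed.

(** The coefficients of [ell] are Cramer's rule for the boundary conditions imposed on a combination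
    of the two exponentials, with determinant [Wr]. *)
Lemma bvp_ell N (r p q c d : 'I_N -> R) lam i (l : 'I_2) :
  0 < lam -> Wr r p q c d lam i != 0 ->
  bvp (p i) (q i) (c i) (d i) (r i) lam (fun=> 0)
    (l == ord0)%:R (l != ord0)%:R (ell r p q c d lam i l).
Proof.
move=> l0 W0; set s := Num.sqrt (2 * lam).
have s0 : 0 < s by rewrite sqrtr_gt0 mulr_gt0.
have s2 : s ^+ 2 = 2 * lam by rewrite sqr_sqrtr// mulr_ge0// ltW.
(* The boundary conditions become a 2 by 2 linear system with rows [(a11, a12)] and [(a21, a22)]. *)
have key (u v : R) b0 b1 : 
  u * a11 p c lam i + v * a12 p c lam i = c i * b0 ->
  u * a21 r q d lam i + v * a22 r q d lam i = d i * b1 ->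
  bvp (p i) (q i) (c i) (d i) (r i) lam (fun=> 0) b0 b1
   (fun x => u * expR (s * x) + v * expR (- (s * x))).
  rewrite /bvp => <- <-; eexists; eexists; split.
    exact: (C2_on_expR _ _ u v (lt0r_neq0 s0)).
  rewrite /a11 /a12 /a21 /a22 -/s s2 !mulr0 oppr0 expR0; split; first by ring.
  split; first by ring.
  by move=> x _; field.
rewrite /ell -/s; move: W0; set W := Wr _ _ _ _ _ _ _ => W0.
case: (l == ord0).
- rewrite (_ : (fun x => c i / _ * _) =
      fun x => (c i / W * a22 r q d lam i) * expR (s * x) +
      (- (c i / W * a21 r q d lam i)) * expR (- (s * x))); last first.
    by apply/funext => x; ring.
  apply: key; last by rewrite mulr0; ring.
  by move: W0; rewrite mulr1 /W /Wr => W0; field.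
- rewrite (_ : (fun x => d i / _ * _) =
      fun x => (- (d i / W * a12 p c lam i)) * expR (s * x) +
      (d i / W * a11 p c lam i) * expR (- (s * x))); last first.
    by apply/funext => x; ring.
  apply: key; first by rewrite mulr0; ring.
  by move: W0; rewrite mulr1 /W /Wr => W0; field.
Qed.

(** A particular solution with uncontrolled boundary data, to be corrected afterwards by the
    functions [ell]. *)
Lemma bvp_particular p q c d r lam g : 0 < c -> 0 < d -> 0 < lam ->
  {within `[0, r], continuous g} -> exists b0 b1 f, bvp p q c d r lam g b0 b1 f.
Proof.
move=> c0 d0 l0 cg; set s := Num.sqrt (2 * lam).
have s0 : 0 < s by rewrite sqrtr_gt0 mulr_gt0.
have s2 : s ^+ 2 = 2 * lam by rewrite sqr_sqrtr// mulr_ge0// ltW.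
have cexp (t k : R) :
    {within `[0, r], continuous (fun x => expR (t * x) * g x * k)}.
  apply/within_itv_cvgP => x xr; move/within_itv_cvgP: cg => /(_ x xr) cg.
  apply: cvgMl; apply: cvgM => //; apply: cvg_within_filter.
  apply: (@cvg_comp _ _ _ ( *%R t) expR _ (nbhs (t * x))); last exact: continuous_expR.
  by apply: cvgMr; exact: cvg_id.
have [F dF] := @within_continuous_antiderivative _ _ _ (cexp (- s) (- s^-1)).
have [G dG] := @within_continuous_antiderivative _ _ _ (cexp s s^-1).
set f := fun x => expR (s * x) * F x + expR (- (s * x)) * G x.
have C2f := @C2_on_variation 0 r s g F G (lt0r_neq0 s0) cg.
(* The data [b0] and [b1] stay open here; they are read off below as the left-hand sides of the
   boundary conditions divided by [c] and [d]. *)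
eexists; eexists; exists f; eexists; eexists; split.
  apply: C2f => x xr.
  by rewrite -mulrN -mulNr; exact: dF.
split; last split.
- by rewrite [RHS]mulrC; apply/esym/(mulfVK (lt0r_neq0 c0)).
- by rewrite [RHS]mulrC; apply/esym/(mulfVK (lt0r_neq0 d0)).
- by move=> x _; rewrite s2 /f; field.
Qed.

(** Subtracting [b0] and [b1] times the two exit functions from a particular solution cancels its
    boundary data. *)
Lemma solves_Ai_exists N (r p q c d : 'I_N -> R) lam i g :
  0 < r i -> 0 <= p i <= 1 -> 0 <= q i <= 1 -> 0 < c i -> 0 < d i -> 0 < lam ->
  {within `[0, r i], continuous g} ->
  exists f, solves_Ai (p i) (q i) (c i) (d i) (r i) lam g f.
Proof.
move=> r0 p01 q01 c0 d0 l0 cg.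
have W0 := ltr0_neq0 (Wr_lt0 r0 p01 q01 c0 d0 l0).
have [b0 [b1 [f Ef]]] := bvp_particular (p i) (q i) c0 d0 l0 cg.
have E0 := bvp_comb (- b0) Ef
  (bvp_ell ord0 l0 W0).
have := bvp_comb (- b1) E0
  (bvp_ell ord_max l0 W0).
rewrite /= !mulr0 !mulr1 !addr0 !subrr => E1.
eexists; apply/solves_AiE; apply: bvp_eq_rhs E1 => x _.
by rewrite !addr0.
Qed.
End resolvent.

(** * Integrals of continuous functions against sub-probability measures on [S_u] *)

Section Su_integral.
Context {R : realType} {N : nat} (r : 'I_N -> R) (mu : @Su_measure R N)
  (mu1 : sub_probability r mu).
Implicit Types f h : 'I_N -> R -> R.

Definition Su_continuous f := forall k, {within `[0, r k], continuous f k}.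

Lemma eq_Su_integral f h : Su_eq r f h -> Su_integral r mu f = Su_integral r mu h.
Proof.
move=> fh; apply: eq_bigr => k _; apply: eq_Rintegral => x.
by rewrite inE/= in_itv/= => /fh.
Qed.

Lemma sub_probability_fin k : (mu k `[0%R, r k]%classic < +oo)%E.
Proof.
apply: (@le_lt_trans _ _ 1%E); last exact: ltry.
apply: le_trans mu1; rewrite (bigD1 k)//= leeDl// sume_ge0//.
Qed.

Lemma Su_continuous_integrable f k : Su_continuous f ->
  (mu k).-integrable `[0, r k] (EFin \o f k).
Proof.
move=> cf; apply: measurable_bounded_integrable => //.
- exact: sub_probability_fin.
- by apply: subspace_continuous_measurable_fun.
- have := compact_bounded (continuous_compact (cf k) (@segment_compact _ _ _)).
  move=> [M [Mr HM]]; exists M; split=> // y My x xr /=.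
  by apply: (HM y My); exists x.
Qed.

Lemma Su_integral_comb f h (t : R) : Su_continuous f -> Su_continuous h ->
  Su_integral r mu (fun k x => f k x + t * h k x) =
  Su_integral r mu f + t * Su_integral r mu h.
Proof.
move=> cf ch; rewrite /Su_integral mulr_sumr -big_split/=; apply: eq_bigr => k _.
have fi := Su_continuous_integrable k cf; have hi := Su_continuous_integrable k ch.
have thi := integrableZl (measurable_itv _) t hi.
by rewrite RintegralD// RintegralZl.
Qed.

(** The integral is at most [M] times the total mass, which may be less than 1; hence the sign
    condition on [M]. *)
Lemma Su_integral_le f (M : R) : 0 <= M -> Su_continuous f ->
  (forall k x, 0 <= x <= r k -> f k x <= M) -> Su_integral r mu f <= M.
Proof.
move=> M0 cf fM.
apply: (@le_trans _ _ (\sum_(k < N) M * fine (mu k `[0%R, r k]%classic))).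
  apply: ler_sum => k _; rewrite -Rintegral_cst//; apply: le_Rintegral => //.
  - exact: Su_continuous_integrable.
  - apply: measurable_bounded_integrable => //; first exact: sub_probability_fin.
    by exists M; split; [exact: num_real|move=> y My x _ /=; rewrite ger0_norm// ltW].
  - by move=> x /=; rewrite in_itv/=; exact: fM.
rewrite -mulr_sumr ler_piMr// -lee_fin -sumEFin.
rewrite (eq_bigr (fun k => mu k `[0%R, r k]%classic))// => k _.
by rewrite fineK// ge0_fin_numE// sub_probability_fin.
Qed.

Lemma Su_continuous_comb f h (t : R) : Su_continuous f -> Su_continuous h ->
  Su_continuous (fun k x => f k x + t * h k x).
Proof.
move=> cf ch k; apply/within_itv_cvgP => x xr.
have /within_itv_cvgP/(_ x xr) cfx := cf k.
have /within_itv_cvgP/(_ x xr) chx := ch k.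
by apply: cvgD => //; apply: cvgMr.
Qed.

Lemma Su_continuous_sum I (s : seq I) (t : I -> R) (h : I -> 'I_N -> R -> R) f :
  Su_continuous f -> (forall a, Su_continuous (h a)) ->
  Su_continuous (fun k x => f k x + \sum_(a <- s) t a * h a k x).
Proof.
move=> cf ch; elim: s => [|a s IH].
  rewrite (_ : (fun _ _ => _) = f)//; apply/funext => k; apply/funext => x.
  by rewrite big_nil addr0.
rewrite (_ : (fun _ _ => _) =
  (fun k x => (f k x + \sum_(a <- s) t a * h a k x) + t a * h a k x)).
  exact: Su_continuous_comb.
by apply/funext => k; apply/funext => x; rewrite big_cons; ring.
Qed.

Lemma Su_integral_sum I (s : seq I) (t : I -> R) (h : I -> 'I_N -> R -> R) f :
  Su_continuous f -> (forall a, Su_continuous (h a)) ->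
  Su_integral r mu (fun k x => f k x + \sum_(a <- s) t a * h a k x) =
  Su_integral r mu f + \sum_(a <- s) t a * Su_integral r mu (h a).
Proof.
move=> cf ch; elim: s => [|a s IH].
  rewrite big_nil addr0; congr Su_integral; apply/funext => k; apply/funext => x.
  by rewrite big_nil addr0.
rewrite (_ : (fun _ _ => _) =
  (fun k x => (f k x + \sum_(a <- s) t a * h a k x) + t a * h a k x)).
  rewrite Su_integral_comb ?IH ?big_cons//; last exact: Su_continuous_sum.
  by ring.
by apply/funext => k; apply/funext => x; rewrite big_cons; ring.
Qed.
End Su_integral.

(** * The coupled problem: uniqueness, construction of a solution, and the linear system *)

Section coupled_resolvent.
Context {R : realType} {N : nat} (r p q c d : 'I_N -> R)
  (P : 'I_N -> 'I_2 -> @Su_measure R N) (lam : R)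
  (r_gt0 : forall i, 0 < r i) (p01 : forall i, 0 <= p i <= 1)
  (q01 : forall i, 0 <= q i <= 1) (c_gt0 : forall i, 0 < c i)
  (d_gt0 : forall i, 0 < d i) (P1 : forall i j, sub_probability r (P i j))
  (lam_gt0 : 0 < lam).
Implicit Types (f g : 'I_N -> R -> R) (u : 'I_N -> 'I_2 -> R).

(** Once [f] is fixed, its integrals are mere numbers, so the nonlocal conditions split into
    separate problems on the intervals. *)
Lemma solves_A_bvp g f : solves_A r p q c d P lam g f <->
  forall i, bvp (p i) (q i) (c i) (d i) (r i) lam (g i)
    (Su_integral r (P i ord0) f) (Su_integral r (P i ord_max) f) (f i).
Proof.
have -> : ord_max = @Ordinal 2 1 isT by exact/val_inj.
by [].
Qed.

Lemma solves_A_continuous g f : solves_A r p q c d P lam g f -> Su_continuous r f.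
Proof. by move=> /solves_A_bvp Ef k; exact: bvp_continuous (Ef k). Qed.

Lemma solves_A_comb (t : R) g g' f f' :
  solves_A r p q c d P lam g f -> solves_A r p q c d P lam g' f' ->
  solves_A r p q c d P lam (fun i x => g i x + t * g' i x)
    (fun i x => f i x + t * f' i x).
Proof.
move=> sf sf'; apply/solves_A_bvp => i.
have cf := solves_A_continuous sf; have cf' := solves_A_continuous sf'.
rewrite !Su_integral_comb//.
by move/solves_A_bvp: sf => /(_ i) sf; move/solves_A_bvp: sf' => /(_ i); exact: bvp_comb.
Qed.

(** The maximum principle at a global maximum over all intervals: if positive, it dominates every
    integral of [f] against a sub-probability measure, as [bvp_max_le0] demands. *)
Lemma solves_A_homogeneous_le0 g f i x : (forall i x, 0 <= x <= r i -> g i x = 0) ->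
  solves_A r p q c d P lam g f -> 0 <= x <= r i -> f i x <= 0.
Proof.
move=> g0 sf xr; have cf := solves_A_continuous sf.
have /choice[X HX] : forall k, exists y, 0 <= y <= r k /\
    forall z, 0 <= z <= r k -> f k z <= f k y.
  move=> k; have [y yr ymax] := EVT_max (ltW (r_gt0 k)) (cf k).
  exists y; split=> [|z zr]; first by move: yr; rewrite in_itv.
  by apply: ymax; rewrite in_itv.
(* [X k] is a maximum point on the [k]-th interval; the global maximum is the largest of these
   finitely many values. *)
case: (@arg_maxP _ _ _ i predT (fun k => f k (X k)) isT) => k _ kmax.
apply: (@le_trans _ _ (f k (X k))).
  by apply: le_trans (kmax i isT); apply: (HX i).2.
move/solves_A_bvp: sf => /(_ k) sf.
apply: (bvp_max_le0 (r_gt0 k) (p01 k) (q01 k) (c_gt0 k) (d_gt0 k) lam_gt0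
  (bvp_eq_rhs (g0 k) sf) (HX k).1 (HX k).2).
move=> /ltW fk0.
by split; apply: Su_integral_le => // j y yr; apply: le_trans (kmax j isT);
  apply: (HX j).2.
Qed.

(** The difference of two solutions solves the homogeneous problem, and so does its negative; both
    are nonpositive. *)
Lemma solves_A_unique g f f' : solves_A r p q c d P lam g f ->
  solves_A r p q c d P lam g f' -> Su_eq r f f'.
Proof.
have le h h' i x : solves_A r p q c d P lam g h -> solves_A r p q c d P lam g h' ->
    0 <= x <= r i -> h i x <= h' i x.
  move=> sh sh' xr; have s := solves_A_comb (-1) sh sh'.
  have := solves_A_homogeneous_le0 _ s xr; rewrite mulN1r subr_le0; apply.
  by move=> j y _; rewrite mulN1r subrr.
by move=> sf sf' i x xr; apply/eqP; rewrite eq_le !le.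
Qed.

(** Since a solution exists, [xget] returns one and not its default value 0. *)
Lemma bvp_R_du g i : {within `[0, r i], continuous g i} ->
  bvp (p i) (q i) (c i) (d i) (r i) lam (g i) 0 0 (R_du r p q c d lam g i).
Proof.
move=> cg; apply/solves_AiE; rewrite /R_du /resolvent_Ai.
by apply: (xgetPex (fun=> 0)); exact: solves_Ai_exists.
Qed.

Lemma bvp_ell_family i l :
  bvp (p i) (q i) (c i) (d i) (r i) lam (fun=> 0)
    (l == ord0)%:R (l != ord0)%:R (ell r p q c d lam i l).
Proof. by apply: bvp_ell => //; exact/ltr0_neq0/Wr_lt0. Qed.

Lemma Su_continuous_ellS k l : Su_continuous r (ellS r p q c d lam k l).
Proof.
move=> m; rewrite /ellS; case: eqVneq => [->|_].
  exact: bvp_continuous (bvp_ell_family k l).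
by apply: continuous_subspaceT => ?; exact: cvg_cst.
Qed.

(** [R_co] is the case where [f] is [R_du g]; a general [f] also allows [f = 0], which the kernel of
    the linear system calls for. *)
Definition add_exits f u : 'I_N -> R -> R :=
  fun i x => f i x + \sum_(k < N) \sum_(l < 2) u k l * ellS r p q c d lam k l i x.

Lemma Su_integral_add_exits f u i j : Su_continuous r f ->
  Su_integral r (P i j) (add_exits f u) = Su_integral r (P i j) f +
    \sum_(k < N) \sum_(l < 2) u k l * Su_integral r (P i j) (ellS r p q c d lam k l).
Proof.
(* The double sum becomes a single sum over pairs, the form treated by [Su_integral_sum]. *)
move=> cf; rewrite pair_bigA/=.
rewrite -(Su_integral_sum _ _ _ (h := fun a => ellS r p q c d lam a.1 a.2)).
- congr Su_integral; apply/funext => m; apply/funext => x.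
  by rewrite /add_exits pair_bigA.
- exact: P1.
- exact: cf.
- by move=> a; exact: Su_continuous_ellS.
Qed.

Lemma add_exitsE f u i x : add_exits f u i x =
  f i x + u i ord0 * ell r p q c d lam i ord0 x
    + u i ord_max * ell r p q c d lam i ord_max x.
Proof.
rewrite /add_exits (bigD1 i)//= [X in _ + (_ + X)]big1 => [|k ki].
  rewrite addr0 big_ord_recr/= big_ord_recr/= big_ord0 add0r addrA /ellS eqxx.
  by have -> : widen_ord (leqnSn 1) ord_max = ord0 by exact/val_inj.
by apply: big1 => l _; rewrite /ellS eq_sym (negPf ki) mulr0.
Qed.

(** On the [i]-th interval the sum has boundary data [u i ord0] and [u i ord_max], and the linear
    system says that these are its own integrals. *)
Lemma solves_A_add_exits g f u :
  (forall i, bvp (p i) (q i) (c i) (d i) (r i) lam (g i) 0 0 (f i)) ->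
  (forall i j, u i j = Su_integral r (P i j) f +
    \sum_(k < N) \sum_(l < 2) u k l * Su_integral r (P i j) (ellS r p q c d lam k l)) ->
  solves_A r p q c d P lam g (add_exits f u).
Proof.
move=> sf uE; apply/solves_A_bvp => i.
have cf : Su_continuous r f by move=> k; exact: bvp_continuous (sf k).
rewrite !Su_integral_add_exits// -!uE.
rewrite (_ : add_exits f u i =
  (fun x => f i x + u i ord0 * ell r p q c d lam i ord0 x
    + u i ord_max * ell r p q c d lam i ord_max x)); last first.
  by apply/funext => x; rewrite add_exitsE.
have := bvp_comb (u i ord_max)
  (bvp_comb (u i ord0) (sf i) (bvp_ell_family i ord0))
  (bvp_ell_family i ord_max).
rewrite /= !mulr0 !mulr1 !addr0 !add0r; apply: bvp_eq_rhs => x _.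
by rewrite !addr0.
Qed.

(** Identity minus the coupling operator of the system for [u], whose unknowns are arranged in a
    matrix to obtain a finite-dimensional vector space. *)
Definition u_map (U : 'M[R]_(N, 2)) : 'M[R]_(N, 2) :=
  \matrix_(i, j) (U i j -
    \sum_(k < N) \sum_(l < 2) U k l * Su_integral r (P i j) (ellS r p q c d lam k l)).

Lemma u_map_linear : linear u_map.
Proof.
move=> t U V; apply/matrixP => i j; rewrite !mxE.
rewrite (_ : \sum_k _ = t * (\sum_(k < N) \sum_(l < 2) U k l *
      Su_integral r (P i j) (ellS r p q c d lam k l)) +
    \sum_(k < N) \sum_(l < 2) V k l *
      Su_integral r (P i j) (ellS r p q c d lam k l)); first by ring.
rewrite mulr_sumr -big_split/=; apply: eq_bigr => k _.
rewrite mulr_sumr -big_split/=; apply: eq_bigr => l _.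
by rewrite !mxE; ring.
Qed.

HB.instance Definition _ := @GRing.isLinear.Build R _ _ *:%R u_map u_map_linear.

(* A vector U in the kernel gives a solution of the problem with g = 0, which
   vanishes by uniqueness; and U is recovered from it by integration. *)
Lemma u_map_ker U : u_map U = 0 -> U = 0.
Proof.
move=> U0; pose z : 'I_N -> R -> R := fun _ _ => 0.
have z0 i j : Su_integral r (P i j) z = 0.
  by rewrite /Su_integral big1// => k _; rewrite Rintegral_cst//= mul0r.
have sz i : bvp (p i) (q i) (c i) (d i) (r i) lam (z i) 0 0 (z i).
  (* The zero solution is obtained as an exit function minus itself. *)
  have := bvp_comb (-1) (bvp_ell_family i ord0) (bvp_ell_family i ord0).
  rewrite !mulN1r !subrr (_ : (fun x => _ x + -1 * _ x) = z i).
    exact: bvp_eq_rhs.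
  by apply/funext => x; rewrite mulN1r subrr.
have cz : Su_continuous r z by move=> k; exact: bvp_continuous (sz k).
have UE i j : U i j = Su_integral r (P i j) z +
    \sum_(k < N) \sum_(l < 2) U k l * Su_integral r (P i j) (ellS r p q c d lam k l).
  rewrite z0 add0r; move/matrixP: U0 => /(_ i j).
  by rewrite !mxE => /eqP; rewrite subr_eq0 => /eqP.
have sAz : solves_A r p q c d P lam z z by apply/solves_A_bvp => i; rewrite !z0.
apply/matrixP => i j; rewrite mxE UE -Su_integral_add_exits//.
by rewrite (eq_Su_integral _ (solves_A_unique (solves_A_add_exits sz UE) sAz)) z0.
Qed.

(** An injective endomorphism of a finite-dimensional space is surjective, so the right-hand side
    [B] has a preimage under [u_map]. *)
Lemma u_system_exists g : exists u, u_system r p q c d P lam g u.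
Proof.
pose L := linfun u_map.
have L0 : lker L == 0%VS.
  apply/lker0P => U V; rewrite !lfunE/= => /eqP; rewrite -subr_eq0 -linearB => /eqP.
  by move=> /u_map_ker/eqP; rewrite subr_eq0 => /eqP.
pose B := \matrix_(i < N, j < 2) Su_integral r (P i j) (R_du r p q c d lam g).
have := lker0_lfunVK L0 B; set U := (L^-1)%VF B; rewrite lfunE/= => UB.
exists (fun i j => U i j) => i j.
move/matrixP: UB => /(_ i j); rewrite !mxE => <-.
by rewrite subrK.
Qed.
End coupled_resolvent.

Theorem theorem6 (R : realType) (N : nat) (r p q c d : 'I_N -> R)
  (P : 'I_N -> 'I_2 -> @Su_measure R N) :
  (0 < N)%N ->
  (forall i, 0 < r i) ->
  (forall i, 0 <= p i <= 1) -> (forall i, 0 <= q i <= 1) ->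
  (forall i, 0 < c i) -> (forall i, 0 < d i) ->
  (forall i j, sub_probability r (P i j)) ->
  forall (lam : R) (g : 'I_N -> R -> R),
    0 < lam ->
    (forall i, {within `[0, r i], continuous g i}) ->
    exists f : 'I_N -> R -> R,
      solves_A r p q c d P lam g f /\
      (forall f', solves_A r p q c d P lam g f' -> Su_eq r f' f) /\
      (exists u, u_system r p q c d P lam g u) /\
      (forall u, u_system r p q c d P lam g u -> Su_eq r f (R_co r p q c d lam g u)).
Proof.
move=> _ r0 p01 q01 c0 d0 P1 lam g l0 cg.
have [u uE] := u_system_exists r0 p01 q01 c0 d0 P1 l0 g.
have sR v : u_system r p q c d P lam g v ->
    solves_A r p q c d P lam g (R_co r p q c d lam g v).
  (* [R_co] unfolds to [add_exits] applied to [R_du g], and [u_system] to the matching fixed-point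
     equation. *)
  by apply: solves_A_add_exits => // i; exact: bvp_R_du.
exists (R_co r p q c d lam g u); split; first exact: sR.
split; first by move=> f' sf'; exact: solves_A_unique sf' (sR u uE).
split; first by exists u.
(* Every solution [v] of the linear system yields a solution of the coupled problem, so uniqueness
   identifies the resulting functions on the intervals. *)
by move=> v vE; exact: solves_A_unique (sR u uE) (sR v vE).
Qed.
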